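(* Let $n\ge2$ and let $(X,F)$ be a symmetric $n$-ary band. For $x,y\in X$ put $B(x,y)=\ell_x(y)=F(x,\ldots,x,y)$, with $x$ repeated $n-1$ times, and let $\ell$ be the map $x\mapsto\ell_x$ from $X$ to the set of all maps $X\to X$. The following conditions are equivalent. (i) The map $\ell$ is constant (i.e., $\ell_x$ is the identity map of $X$ for any $x\in X$). (ii) $(X,F)$ is the $n$-ary extension of an Abelian group $(X,\ast)$ (and in particular the exponent of $(X,\ast)$ divides $n-1$). (iii) The band $(X,B)$ is a right zero semigroup.
   Context: An operation $F\colon X^n\to X$ ($X$ nonempty) is associative if $F(x_1,\ldots,x_{i-1},F(x_i,\ldots,x_{i+n-1}),x_{i+n},\ldots,x_{2n-1})=F(x_1,\ldots,x_i,F(x_{i+1},\ldots,x_{i+n}),x_{i+n+1},\ldots,x_{2n-1})$ for all $x_1,\ldots,x_{2n-1}\in X$ and $1\le i\le n-1$. A symmetric $n$-ary band is a pair $(X,F)$ with $F$ associative, invariant under permutations of its arguments, and idempotent ($F(x,\ldots,x)=x$ for all $x$). A band is an idempotent semigroup; $(X,B)$ is a band. A right zero semigroup is a semigroup $(X,G)$ with $G(x,y)=y$ for all $x,y\in X$. The $n$-ary extension of a semigroup $(X,\ast)$ is $(X,F)$ with $F(x_1,\ldots,x_n)=x_1\ast\cdots\ast x_n$. The exponent of a group with neutral element $e$ is the smallest integer $m\ge1$ such that $x^m=e$ for all $x$ (when such an $m$ exists). *)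

(* Defs.v *)
From mathcomp Require Import all_boot all_fingroup.

Set Implicit Arguments.
Unset Strict Implicit.
Unset Printing Implicit Defensive.

Section NaryOperations.

Variables (X : Type) (n : nat).
Implicit Type F : n.-tuple X -> X.

(* F (x_0, ..., x_(i-1), F (x_i, ..., x_(i+n-1)), x_(i+n), ..., x_(2n-2));
   the arguments are counted from 0, and for i < n only the first 2n-1 terms
   of the sequence x are used. *)
Definition nary_nested F (x : nat -> X) (i : nat) : X :=
  F [tuple if k < i then x k
           else if k == i :> nat then F [tuple x (i + j) | j < n]
           else x (k + n.-1) | k < n].

Definition nary_associative F : Prop :=
  forall (x : nat -> X) (i : nat),
    i.+1 < n -> nary_nested F x i = nary_nested F x i.+1.

Definition nary_symmetric F : Prop :=
  forall (s : 'S_n) (t : n.-tuple X), F [tuple tnth t (s k) | k < n] = F t.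

Definition nary_idempotent F : Prop :=
  forall x : X, F [tuple x | _ < n] = x.

Definition symmetric_nary_band F : Prop :=
  [/\ nary_associative F, nary_symmetric F & nary_idempotent F].

(* ell F x y = F (x, ..., x, y), which is also the binary operation B(x, y). *)
Definition ell F (x y : X) : X :=
  F [tuple if k < n.-1 then x else y | k < n].

(* For n = 0 this would hold vacuously; it is used with n >= 2 only. *)
Definition nary_extension F (op : X -> X -> X) : Prop :=
  forall (t : n.-tuple X) (x : X) (s : seq X),
    tval t = x :: s -> F t = foldl op x s.

End NaryOperations.

Definition constant_map (X Y Z : Type) (f : X -> Y -> Z) : Prop :=
  exists c : Y -> Z, forall x : X, f x =1 c.

Definition right_zero_semigroup (X : Type) (op : X -> X -> X) : Prop :=
  associative op /\ forall x y : X, op x y = y.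

Definition abelian_group (X : Type) (op : X -> X -> X) (e : X) : Prop :=
  [/\ associative op, commutative op, left_id e op
    & forall x : X, exists y : X, op y x = e].

Definition power_identity (X : Type) (op : X -> X -> X) (e : X) (m : nat) : Prop :=
  forall x : X, iter m (op x) e = e.

Definition is_exponent (X : Type) (op : X -> X -> X) (e : X) (m : nat) : Prop :=
  [/\ 0 < m, power_identity op e m
    & forall k : nat, 0 < k -> power_identity op e k -> m <= k].

(* Main.v *)
Require Import Defs.
From mathcomp Require Import all_boot all_fingroup.
From mathcomp Require Import boolp.

(** If [ell] is constant, idempotency evaluates its value at [y] as
[ell F y y = y], so every [ell F x] is the identity ([constant_ell_id]); this
is also what it means for [B] to be a right zero operation.  The content is
therefore the equivalence of the condition [ell F x =1 id] with condition (ii).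

From a group to the identity maps: in an Abelian group whose [n]-ary extension
is idempotent, [x ^ n = x], hence [x ^ (n - 1) = e] and
[F (x, ..., x, y) = x ^ (n - 1) * y = y].  The same identity shows that the
group has an exponent, which divides [n - 1] since the remainder of [n - 1]
modulo the exponent is again a power killing the group.

From the identity maps to a group: choose any element [e] and put
[x * y = F (x, y, e, ..., e)].  The hypothesis says that [n - 1] equal arguments
of [F] can be erased ([word_op_nseq_perm]); so [e] is neutral, and
[F (e, e, x, ..., x)], with [n - 2] copies of [x], is an inverse of [x]
([base_op_group]).  That [F] is the extension of this group is proved by
showing, by induction on the length, that a product of at most [n] factors is
[F] applied to these factors padded with copies of [e]
([foldl_base_op]).

The operation [F] is handled through words: [word_op] evaluates [F] at a
sequence, so that associativity becomes a statement about concatenations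
([word_op_assoc]) and symmetry becomes invariance under [perm_eq]
([word_op_perm]).  As [perm_eq] needs decidable equality, this part lives over
an [eqType], and the theorem uses it at [X] with its classical equality.  The
existence of a least exponent uses classical logic too.

Outside this comment the arity is [n.+2] wherever it has to be at least two. *)

Set Implicit Arguments.
Unset Strict Implicit.
Unset Printing Implicit Defensive.

Section AbelianGroup.

Variables (X : Type) (op : X -> X -> X) (e : X).
Hypothesis groupX : abelian_group op e.

Lemma abelian_group_right_id : right_id e op.
Proof. by have [_ opC op1x _] := groupX; move=> x; rewrite opC op1x. Qed.

Lemma abelian_group_absorb a x : op a x = x -> a = e.
Proof.
have [opA opC _ opV] := groupX => axx; have [y yx] := opV x.
by rewrite -(abelian_group_right_id a) -yx (opC y) opA axx.
Qed.

Lemma iter_op_power m x z : iter m (op x) z = op (iter m (op x) e) z.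
Proof.
have [opA _ op1x _] := groupX.
by elim: m => [|m IHm] /=; rewrite ?op1x // IHm opA.
Qed.

Lemma foldl_op_nseq m x z : foldl op z (nseq m x) = iter m (op x) z.
Proof.
have [_ opC _ _] := groupX.
by elim: m z => [|m IHm] z //=; rewrite IHm [op z x]opC -iterSr.
Qed.

(** The powers that kill the whole group are stable under Euclidean division,
which is why the least positive one divides all of them. *)
Lemma power_identity_mod m k :
  power_identity op e m -> power_identity op e k ->
  power_identity op e (k %% m).
Proof.
have [_ _ op1x _] := groupX => em ek x.
have multm q z : iter (q * m) (op x) z = z.
  by elim: q => // q IHq; rewrite mulSn iterD IHq iter_op_power em op1x.
by have := ek x; rewrite {1}(divn_eq k m) iterD multm.
Qed.

(** The least positive [m] is found by a search among natural numbers, which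
needs a boolean predicate: [power_identity] quantifies over all of [X] and is
made boolean by excluded middle. *)
Lemma exponent_dvd k :
  0 < k -> power_identity op e k -> exists2 m, is_exponent op e m & m %| k.
Proof.
move=> k_gt0 ek; pose P m := (0 < m) && `[< power_identity op e m >].
have exP : exists m, P m by exists k; rewrite /P k_gt0; apply/asboolP.
case: (ex_minnP exP) => m /andP[m_gt0 /asboolP em] m_min.
exists m.
  split=> // j j_gt0 ej; apply: m_min; rewrite /P j_gt0; exact/asboolP.
rewrite /dvdn -leqn0 leqNgt; apply/negP => r_gt0.
suff : m <= k %% m by rewrite leqNgt ltn_pmod.
by apply: m_min; rewrite /P r_gt0; apply/asboolP/power_identity_mod.
Qed.

Variables (n : nat) (F : n.+2.-tuple X -> X).
Hypothesis F_ext : nary_extension F op.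

(** Idempotency reads [x ^ n.+2 = x], and one factor [x] cancels. *)
Lemma nary_extension_power :
  nary_idempotent F -> power_identity op e n.+1.
Proof.
move=> F_idem x; apply: (@abelian_group_absorb _ x).
rewrite -iter_op_power -foldl_op_nseq -[RHS](F_idem x).
rewrite (@F_ext _ x (nseq n.+1 x)) //.
apply: (@eq_from_nth _ x) => [|i]; rewrite size_tuple.
  by rewrite /= size_nseq.
move=> lt_i; rewrite -[i in LHS]/(nat_of_ord (Ordinal lt_i)) -tnth_nth.
by rewrite tnth_mktuple (nth_nseq x n.+2) if_same.
Qed.

Lemma nary_extension_ell : nary_idempotent F -> forall x, ell F x =1 id.
Proof.
have [_ opC op1x _] := groupX => F_idem x y.
rewrite /ell (@F_ext _ x (rcons (nseq n x) y)).
  rewrite foldl_rcons foldl_op_nseq iter_op_power opC.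
  by rewrite [op _ x]opC -iterS nary_extension_power // opC op1x.
apply: (@eq_from_nth _ x) => [|i]; rewrite size_tuple.
  by rewrite /= size_rcons size_nseq.
move=> lt_i; rewrite -[i in LHS]/(nat_of_ord (Ordinal lt_i)) -tnth_nth.
rewrite tnth_mktuple -rcons_cons -[x :: _]/(nseq n.+1 x) nth_rcons /= size_nseq.
rewrite (nth_nseq x n.+1) if_same -[i < n.+1]/(i <= n); case: leqP => // lt_n.
by rewrite eqn_leq lt_n -ltnS lt_i.
Qed.

End AbelianGroup.

Section Words.

Variables (X : eqType) (n : nat) (F : n.+2.-tuple X -> X) (e : X).
Hypothesis F_band : symmetric_nary_band F.

(** Meant for words of length [n.+2]; the element [e] is both the default value
that makes [word_op] total and, later on, the neutral element. *)
Definition word_op (s : seq X) : X := F [tuple nth e s k | k < n.+2].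
Local Notation f := word_op.

Lemma word_op_tuple (t : n.+2.-tuple X) : f t = F t.
Proof.
rewrite /f; congr F; apply/eq_from_tnth => k.
by rewrite tnth_mktuple -tnth_nth.
Qed.

Lemma word_op_perm s t : size s = n.+2 -> perm_eq s t -> f s = f t.
Proof.
have [_ F_sym _] := F_band => size_s perm_st.
have size_t : size t == n.+2 by rewrite -(perm_size perm_st) size_s.
have [p ->] := (tuple_permP (t := Tuple size_t) perm_st).
by rewrite word_op_tuple F_sym -word_op_tuple.
Qed.

Lemma word_op_idem x : f (nseq n.+2 x) = x.
Proof.
have [_ _ F_idem] := F_band; rewrite -[RHS]F_idem; congr F.
by apply: eq_from_tnth => k; rewrite !tnth_mktuple nth_nseq ltn_ord.
Qed.

Lemma word_op_ell x y : ell F x y = f (rcons (nseq n.+1 x) y).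
Proof.
congr F; apply: eq_from_tnth => k; rewrite !tnth_mktuple.
rewrite nth_rcons size_nseq nth_nseq /=; case: ifP => // k_ge.
by rewrite eqn_leq -ltnS ltn_ord leqNgt k_ge.
Qed.

(** Dictionary between the indexed form of nesting and words: the inner
application of [F] covers the factor [b]. *)
Lemma nary_nested_word s b c :
    size b = n.+2 -> size (s ++ c) = n.+1 ->
  nary_nested F (nth e (s ++ b ++ c)) (size s) = f (s ++ f b :: c).
Proof.
rewrite size_cat => size_b size_sc; congr F.
apply: eq_from_tnth => k; rewrite !tnth_mktuple !nth_cat.
case: ltnP => // le_sk; case: eqP => [-> | ne_ks].
  rewrite subnn /=; congr F; apply: eq_from_tnth => j.
  by rewrite !tnth_mktuple !nth_cat ltnNge leq_addr addKn size_b ltn_ord.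
have lt_sk : size s < k by rewrite ltn_neqAle le_sk andbT; apply/eqP/nesym.
rewrite ltnNge (leq_trans le_sk) ?leq_addr //= size_b.
rewrite -addnBAC // -(subnSK lt_sk) addSnnS /= ltnNge leq_addl /=.
by rewrite addnK.
Qed.

(** Associativity shifts the inner [F] by one position at a time; iterating it
moves the inner [F] across the prefix [a]. *)
Lemma word_op_assoc a b c d :
    size (a ++ b) = n.+2 -> size (c ++ d) = n.+1 -> size a = size c ->
  f (f (a ++ b) :: c ++ d) = f (a ++ f (b ++ c) :: d).
Proof.
have [F_assoc _ _] := F_band => size_ab size_cd size_ac.
have size_bc : size (b ++ c) = n.+2.
  by rewrite -size_ab !size_cat size_ac addnC.
rewrite -[RHS]nary_nested_word //; last by rewrite size_cat size_ac -size_cat.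
rewrite -[LHS](@nary_nested_word [::]) //= -!catA.
have : size a < n.+2.
  by rewrite size_ac ltnS -size_cd size_cat leq_addr.
elim: (size a) => // i IHi lt_i; rewrite -F_assoc //; exact: IHi (ltnW lt_i).
Qed.

Hypothesis ell_id : forall x, ell F x =1 id.

(** By symmetry, [n.+1] equal arguments are erased wherever they stand. *)
Lemma word_op_nseq_perm x y s :
  perm_eq s (y :: nseq n.+1 x) -> f s = y.
Proof.
move=> perm_s; rewrite -[RHS](ell_id x) word_op_ell; apply: word_op_perm.
  by rewrite (perm_size perm_s) /= size_nseq.
by rewrite (perm_trans perm_s) // perm_sym perm_rcons.
Qed.

Definition base_op x y : X := f (x :: y :: nseq n e).

Lemma base_op_group : abelian_group base_op e.
Proof.
have opC : commutative base_op.
  move=> x y; apply: word_op_perm; first by rewrite /= size_nseq.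
  exact: (permEl (perm_catCA [:: x] [:: y] _)).
split=> //.
- move=> x y z; rewrite /base_op.
  rewrite -[x :: y :: _]/([:: x] ++ _) -[z :: _]/([:: z] ++ nseq n e).
  rewrite (@word_op_assoc [:: x]) /= ?size_nseq //.
  congr (f [:: _, _ & _]); apply: word_op_perm => /=.
    by rewrite size_nseq.
  by rewrite perm_cons; exact: (permEl (perm_catC [:: z] _)).
- move=> y; apply: (@word_op_nseq_perm e).
  exact: (permEl (perm_catCA [:: e] [:: y] _)).
(* Shifting the inner [F] in F (F (e, e, x, ..., x), x, e, ..., e) by one place
   gives F (e, F (e, x, ..., x), e, ..., e), whose inner value is [e]. *)
move=> x; exists (f [:: e, e & nseq n x]); rewrite /base_op.
rewrite -[e :: e :: _]/([:: e] ++ _) -[x :: _]/([:: x] ++ nseq n e).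
rewrite (@word_op_assoc [:: e]) /= ?size_nseq //.
rewrite [f (e :: _ ++ _)](@word_op_nseq_perm x e).
  exact: word_op_idem.
by rewrite perm_cons -[x :: nil]/(nseq 1 x) -nseqD addn1.
Qed.

(** Padding is what makes the induction go through: all partial products are
values of [F], although they have fewer factors than [F] has arguments. *)
Lemma foldl_base_op x s :
    size s <= n.+1 ->
  foldl base_op x s = f ((x :: s) ++ nseq (n.+1 - size s) e).
Proof.
elim/last_ind: s => [|s y IHs] /=.
  by move=> _; rewrite (@word_op_nseq_perm e x).
rewrite size_rcons => lt_s; rewrite foldl_rcons IHs ?(ltnW lt_s) //.
rewrite subSS subSn //; have := @subnKC _ n lt_s.
move: (n - size s) => j def_n.
have size_w : size ((x :: s) ++ nseq j.+1 e) = n.+2.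
  by rewrite size_cat size_nseq /= addSn addnS def_n.
(* Once the [j.+1] padding copies of [e] stand in front, shifting the inner [F]
   past them leaves outside it exactly n.+1 copies of [e], which are erased. *)
rewrite /base_op (@word_op_perm ((x :: s) ++ _) (nseq j.+1 e ++ (x :: s))) //;
  last by rewrite perm_catC.
have -> : nseq n e = nseq j e ++ nseq (size s) e by rewrite -nseqD addnC def_n.
rewrite -[y :: _]/((y :: nseq j e) ++ nseq (size s) e) word_op_assoc.
- rewrite (@word_op_nseq_perm e (f ((x :: s) ++ y :: nseq j e))).
    by rewrite -cat_cons -rcons_cons -cats1 -catA.
  by rewrite -cat1s perm_catCA -nseqD addSn addnC def_n.
- by rewrite size_cat addnC -size_cat.
- by rewrite size_cat /= !size_nseq addSn addnC def_n.
by rewrite /= !size_nseq.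
Qed.

Lemma base_op_extension : nary_extension F base_op.
Proof.
move=> t x s def_t.
have [size_s] : size (x :: s) = n.+2 by rewrite -def_t size_tuple.
by rewrite foldl_base_op size_s // subnn cats0 -def_t word_op_tuple.
Qed.

End Words.

Lemma constant_ell_id (X : Type) n (F : n.-tuple X -> X) :
  nary_idempotent F -> constant_map (ell F) -> forall x, ell F x =1 id.
Proof.
move=> F_idem [c ell_c] x y; rewrite ell_c -(ell_c y) -[RHS]F_idem; congr F.
by apply: eq_from_tnth => k; rewrite !tnth_mktuple if_same.
Qed.

Theorem proposition3p9 (X : Type) (n : nat) (F : n.-tuple X -> X)
    (X_nonempty : inhabited X) (n_ge2 : 2 <= n)
    (F_band : symmetric_nary_band F) :
  let B : X -> X -> X := fun x y => ell F x y in
  let cond_i := constant_map (ell F) in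
  let cond_ii := exists (op : X -> X -> X) (e : X),
    abelian_group op e /\ nary_extension F op in
  let cond_iii := right_zero_semigroup B in
  [/\ cond_i <-> cond_ii,
      cond_ii <-> cond_iii,
      (* the parenthetical claims of (i) and of (ii) *)
      cond_i <-> (forall x : X, ell F x =1 id)
    & forall (op : X -> X -> X) (e : X),
        abelian_group op e -> nary_extension F op ->
        exists2 m : nat, is_exponent op e m & m %| n.-1].
Proof.
case: n n_ge2 F F_band => [|[|n]] // _ F F_band B cond_i cond_ii cond_iii.
have [_ _ F_idem] := F_band.
have iE : cond_i <-> (forall x : X, ell F x =1 id).
  by split=> [|ell_id]; [apply: constant_ell_id | exists id].
have iiE : cond_ii <-> (forall x : X, ell F x =1 id).
  split=> [[op [e [groupX F_ext]]] | ell_id].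
    exact: (nary_extension_ell groupX F_ext F_idem).
  case: X_nonempty => e; exists (@base_op {classic X} n F e), e.
  by split; [apply: (@base_op_group {classic X})
           | apply: (@base_op_extension {classic X})].
have iiiE : cond_iii <-> (forall x : X, ell F x =1 id).
  split=> [[_ B_r] //| ell_id]; split=> [x y z|x y]; rewrite /B !ell_id //.
split=> //; first exact: iff_trans iE (iff_sym iiE).
  exact: iff_trans iiE (iff_sym iiiE).
move=> op e groupX F_ext; apply: (exponent_dvd groupX) => //.
rewrite [n.+2.-1]/=; exact: (nary_extension_power groupX F_ext F_idem).
Qed.
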